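(* Let $\mathcal{DG}=\{\mathcal{V},\mathcal{E}\}$ and $\mathcal{DG}'=\{\mathcal{V}',\mathcal{E}'\}$ be two dynamic graphs with node features $\mathbf{X}$ and $\mathbf{X}'$ respectively. Let $l$ be a labeling of the node pairs of both graphs by natural numbers such that, for all $(u,v)\in[\mathcal{V}]^2$ and $(u',v')\in[\mathcal{V}']^2$, $l((u,v))=l((u',v'))$ if and only if $[\mathbf{X}_u\|\mathbf{X}_v]=[\mathbf{X}'_{u'}\|\mathbf{X}'_{v'}]$. Let $t$ be a time, let $c_t^{(j)}$ denote the color at time $t$ obtained by the 2-DWL test initialized with $l$ at the $j$-th iteration, and let $h_t^{(j)}$ denote the $j$-th layer temporal embeddings of node pairs output by a Global HopeDGN (the same one applied to both graphs). Then for all $j\ge0$, all $(u,v)\in[\mathcal{V}]^2$ and all $(u',v')\in[\mathcal{V}']^2$, $$c_t^{(j)}\big((u,v)\big)=c_t^{(j)}\big((u',v')\big)\ \Longrightarrow\ h_t^{(j)}\big((u,v)\big)=h_t^{(j)}\big((u',v')\big).$$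
   Context: Dynamic graph: $\mathcal{DG}=\{\mathcal{V},\mathcal{E}\}$ with $\mathcal{V}$ a finite node set and $\mathcal{E}=\{(u_1,v_1,t_1),(u_2,v_2,t_2),\dots\}$ a finite sequence of interactions with real timestamps $t_i\le t_{i+1}$; $(u_i,v_i,t_i)$ means nodes $u_i$ and $v_i$ interact at time $t_i$. Interactions are undirected, and the same pair may interact several times. Node features form a matrix $\mathbf{X}\in\mathbb{R}^{|\mathcal{V}|\times d_N}$ with row $\mathbf{X}_u$ for node $u$ (same $d_N$ for both graphs). $[\mathcal{V}]^2$ is the set of ordered pairs of nodes. Dynamic Adjacency Tensor (DAT): $\mathsf{A}$ is indexed by $\mathcal{V}\times\mathcal{V}\times\{1,\dots,T\}$, where $\mathsf{A}_{u,v,:}=[t_1,\dots,t_{q(u,v)},\infty,\dots,\infty]$ lists in nondecreasing order the timestamps of the $q(u,v)$ interactions between $u$ and $v$, padded by $\infty$ to length $T$. Thus $\mathsf{A}_{u,v,:}=\mathsf{A}_{v,u,:}$. $T$ is at least the maximum interaction count of any pair, and a common $T$ is used for the two graphs being compared. Historical DAT: $\mathsf{A}^{<t}_{i,j,k}=\mathsf{A}_{i,j,k}$ if $\mathsf{A}_{i,j,k}<t$, and $\infty$ otherwise. Time Interval Tensor: $\mathsf{B}^t_{i,j,k}=t-\mathsf{A}^{<t}_{i,j,k}$ if $\mathsf{A}^{<t}_{i,j,k}<t$, and $\infty$ otherwise. $\{\!\!\{\cdot\}\!\!\}$ denotes a multiset, $\|$ denotes concatenation; $\mathrm{HASH}$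 is an injective function of its arguments, the same for both graphs. 2-DWL test at time $t$: for $\mathbf{s}=(v_1,v_2)$, $c_t^{(0)}(\mathbf{s})=l(\mathbf{s})$ and for $j>0$ $$c_t^{(j)}(\mathbf{s})=\mathrm{HASH}\Big(c_t^{(j-1)}(\mathbf{s}),\ \{\!\!\{\big(c_t^{(j-1)}((w,v_2)),\,c_t^{(j-1)}((v_1,w)),\,\mathsf{A}^{<t}_{w,v_1,:},\,\mathsf{A}^{<t}_{w,v_2,:}\big): w\in\mathcal{V}\}\!\!\}\Big).$$ Global HopeDGN: given functions $\mathrm{UPDATE}$ (on pairs of vectors), $\mathrm{AGG}$ (on multisets of vectors), $f_1$ and $f_2$ (on vectors, entries of the argument of $f_2$ possibly $\infty$), the embeddings of a node pair $\mathbf{s}=(u,v)$ at time $t$ are $h_t^{(0)}(\mathbf{s})=[\mathbf{X}_u\|\mathbf{X}_v]$ and for $l>0$ $$h_t^{(l)}(\mathbf{s})=\mathrm{UPDATE}\big(h_t^{(l-1)}(\mathbf{s}),\tilde h_t^{(l)}(\mathbf{s})\big),\qquad \tilde h_t^{(l)}(\mathbf{s})=\mathrm{AGG}\big(\{\!\!\{\psi_t(\mathbf{s},w): w\in\mathcal{V}\}\!\!\}\big),$$ $$\psi_t(\mathbf{s},w)=\Big[f_1\big([h_t^{(l-1)}((u,w))\,\|\,h_t^{(l-1)}((v,w))]\big)\ \Big\|\ f_2\big([\mathsf{B}^t_{u,w,:}\,\|\,\mathsf{B}^t_{v,w,:}]\big)\Big].$$ *)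

(* Defs.v *)
From mathcomp Require Import all_boot all_order all_algebra.
From mathcomp Require Import finmap multiset.
From mathcomp Require Import reals constructive_ereal.

Set Implicit Arguments.
Unset Strict Implicit.
Unset Printing Implicit Defensive.

Import Order.TTheory GRing.Theory Num.Theory.
Local Open Scope ring_scope.
Local Open Scope ereal_scope.
Local Open Scope mset_scope.

Record dyngraph (R : realType) := DynGraph {
  node :> finType;
  interactions : seq (node * node * R);
  interactions_sorted : sorted <=%R [seq e.2 | e <- interactions]
}.

(* {{ f w : w in V }} *)
Definition msetmap (V : finType) (K : choiceType) (f : V -> K) : {mset K} :=
  seq_mset [seq f w | w <- enum V].

Section Tensors.
Variables (R : realType) (G : dyngraph R) (T : nat).

(* Interactions are undirected, so (u, v, t) and (v, u, t) both count for the
   pair u, v. The result is nondecreasing because the interactions are sorted. *)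
Definition timestamps (u v : G) : seq R :=
  [seq e.2 | e <- interactions G & (e.1 == (u, v)) || (e.1 == (v, u))].

(* The third index ranges over 0, ..., T - 1 instead of 1, ..., T. *)
Definition DAT (u v : G) (k : 'I_T) : \bar R :=
  nth +oo [seq r%:E | r <- timestamps u v] k.

Definition histDAT (t : R) (u v : G) (k : 'I_T) : \bar R :=
  if DAT u v k < t%:E then DAT u v k else +oo.

Definition time_interval (t : R) (u v : G) (k : 'I_T) : \bar R :=
  if histDAT t u v k < t%:E then t%:E - histDAT t u v k else +oo.

Definition histDAT_vec (t : R) (u v : G) : T.-tuple (\bar R) :=
  [tuple histDAT t u v k | k < T].

Definition time_interval_vec (t : R) (u v : G) : T.-tuple (\bar R) :=
  [tuple time_interval t u v k | k < T].

End Tensors.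

Definition hash_arg (R : realType) (T : nat) (C : choiceType) : Type :=
  (C * {mset (C * C * T.-tuple (\bar R) * T.-tuple (\bar R))%type})%type.

(* Timestamps are arbitrary reals, so an injective HASH cannot take its values
   in nat; colors live in a type C, and col embeds the labels into it. *)
Fixpoint dwl2 (R : realType) (G : dyngraph R) (T : nat) (C : choiceType)
    (HASH : hash_arg R T C -> C) (col : nat -> C) (l : G * G -> nat) (t : R)
    (j : nat) (s : G * G) : C :=
  if j is j'.+1 then
    let c := dwl2 HASH col l t j' in
    HASH (c s, msetmap (fun w : G =>
      (c (w, s.2), c (s.1, w),
       histDAT_vec T t w s.1, histDAT_vec T t w s.2)))
  else col (l s).

(* Rows of X are numbered by the enumeration of the nodes. *)
Definition node_feature (R : realType) (G : dyngraph R) (dN : nat)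
    (X : 'M[R]_(#|G|, dN)) (u : G) : seq R :=
  [seq X (enum_rank u) i | i <- enum 'I_dN].

Definition pair_feature (R : realType) (G : dyngraph R) (dN : nat)
    (X : 'M[R]_(#|G|, dN)) (s : G * G) : seq R :=
  node_feature X s.1 ++ node_feature X s.2.

(* A vector is a sequence, of any length: the same functions are applied in
   every layer, and the dimension of the embeddings may vary with the layer. *)
Record hopeDGN (R : realType) := HopeDGN {
  update : seq R -> seq R -> seq R;
  agg : {mset (seq R)} -> seq R;
  f1 : seq R -> seq R;
  f2 : seq (\bar R) -> seq R
}.

Fixpoint embedding (R : realType) (M : hopeDGN R) (G : dyngraph R) (dN : nat)
    (X : 'M[R]_(#|G|, dN)) (T : nat) (t : R) (j : nat) (s : G * G) : seq R :=
  if j is j'.+1 then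
    let h := embedding M X T t j' in
    let psi w :=
      f1 M (h (s.1, w) ++ h (s.2, w)) ++
      f2 M (time_interval_vec T t s.1 w ++ time_interval_vec T t s.2 w) in
    update M (h s) (agg M (msetmap psi))
  else pair_feature X s.

(* Main.v *)
(* Equal 2-DWL colors of (u, v) and (u', v') force equal colors of (v, u) and
   (v', u'), since exchanging the two nodes only permutes the components of the
   tuples in the multiset. This is needed because 2-DWL looks at (w, v) where
   HopeDGN looks at (v, w). The rest is an induction on the iteration: each
   tuple aggregated by 2-DWL determines the vector aggregated by HopeDGN. *)
Require Import Defs.
From mathcomp Require Import all_boot all_order all_algebra.
From mathcomp Require Import finmap multiset.
From mathcomp Require Import reals constructive_ereal.

Set Implicit Arguments.
Unset Strict Implicit.
Unset Printing Implicit Defensive.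

(** Induction on [s], matching its head with any [y] of [s'] that has the same key and removing that
    [y]. Which [y] is taken does not matter, because the key alone determines the [g'] value. *)
Lemma perm_map_factor (A B : eqType) (K L : eqType) (f : A -> K) (f' : B -> K)
    (g : A -> L) (g' : B -> L) (s : seq A) (s' : seq B) :
  (forall x y, f x = f' y -> g x = g' y) ->
  perm_eq (map f s) (map f' s') -> perm_eq (map g s) (map g' s').
Proof.
move=> fg; elim: s s' => [|x s IHs] s' /= eq_ff'.
  by move: (perm_size eq_ff'); rewrite size_map; case: s' {eq_ff'}.
have /mapP[y s'y fxy] : f x \in map f' s'.
  by rewrite -(perm_mem eq_ff') mem_head.
have s'E := perm_to_rem s'y.
rewrite (permPr (perm_map g' s'E)) /= (fg _ _ fxy) perm_cons.
apply: IHs; rewrite -(perm_cons (f x)) (permPl eq_ff') fxy.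
exact: (perm_map f' s'E).
Qed.

Lemma msetmap_factor (V V' : finType) (K L : choiceType) (f : V -> K)
    (f' : V' -> K) (g : V -> L) (g' : V' -> L) :
  (forall w w', f w = f' w' -> g w = g' w') ->
  msetmap f = msetmap f' -> msetmap g = msetmap g'.
Proof.
move=> fg eq_ff'; apply/eq_seq_msetP; apply: perm_map_factor fg _.
exact/eq_seq_msetP.
Qed.

Lemma timestampsC (R : realType) (G : dyngraph R) (u v : G) :
  timestamps u v = timestamps v u.
Proof. by congr map; apply: eq_filter => e; rewrite orbC. Qed.

(** Each interval entry is a function of the matching entry of [histDAT]. The nodes are exchanged
    between hypothesis and conclusion because 2-DWL records the pair [(w, v)] and HopeDGN the pair
    [(v, w)]; interactions are undirected. *)
Lemma time_interval_vec_factor (R : realType) (G G' : dyngraph R) (T : nat)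
    (t : R) (u v : G) (u' v' : G') :
  histDAT_vec T t v u = histDAT_vec T t v' u' ->
  time_interval_vec T t u v = time_interval_vec T t u' v'.
Proof.
move=> eqA; apply: eq_from_tnth => k; rewrite !tnth_mktuple /time_interval.
suff -> : histDAT t u v k = histDAT t u' v' k by [].
move/(congr1 (fun A => tnth A k)): eqA; rewrite !tnth_mktuple /histDAT /DAT.
by rewrite (timestampsC v) (timestampsC v').
Qed.

Lemma size_node_feature (R : realType) (G : dyngraph R) (dN : nat)
    (X : 'M[R]_(#|G|, dN)) (u : G) : size (node_feature X u) = dN.
Proof. by rewrite size_map size_enum_ord. Qed.

(** All rows have the same length [dN], so the concatenation splits uniquely into its two halves. *)
Lemma pair_feature_swap (R : realType) (G G' : dyngraph R) (dN : nat)
    (X : 'M[R]_(#|G|, dN)) (X' : 'M[R]_(#|G'|, dN)) (u v : G) (u' v' : G') :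
  pair_feature X (u, v) = pair_feature X' (u', v') ->
  pair_feature X (v, u) = pair_feature X' (v', u').
Proof.
move/eqP; rewrite /pair_feature /= eqseq_cat ?size_node_feature //.
by case/andP=> /eqP -> /eqP ->.
Qed.

Lemma dwl2_swap (R : realType) (G G' : dyngraph R) (T : nat) (C : choiceType)
    (HASH : hash_arg R T C -> C) (col : nat -> C)
    (l : G * G -> nat) (l' : G' * G' -> nat) (t : R) :
  injective HASH -> injective col ->
  (forall u v u' v', l (u, v) = l' (u', v') -> l (v, u) = l' (v', u')) ->
  forall j u v u' v',
    dwl2 HASH col l t j (u, v) = dwl2 HASH col l' t j (u', v') ->
    dwl2 HASH col l t j (v, u) = dwl2 HASH col l' t j (v', u').
Proof.
move=> HASH_inj col_inj l_swap; elim=> [|j IHj] u v u' v' /=.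
  by move/col_inj/l_swap->.
move/HASH_inj => [/IHj-> eq_ms]; congr (HASH (_, _)).
apply: msetmap_factor eq_ms => w w' /=.
case/pair_equal_spec=> /pair_equal_spec[].
(* Reversed, the colors of [(w, v)] and [(u, w)] become those of [(v, w)] and [(w, u)], the two that
   the tuple for [(v, u)] contains. *)
case/pair_equal_spec=> /IHj-> /IHj-> Au Av.
by rewrite Au Av.
Qed.

Theorem proposition4 (R : realType) (G G' : dyngraph R) (dN : nat)
    (X : 'M[R]_(#|G|, dN)) (X' : 'M[R]_(#|G'|, dN))
    (T : nat)
    (hT : forall u v : G, size (timestamps u v) <= T)
    (hT' : forall u v : G', size (timestamps u v) <= T)
    (C : choiceType) (HASH : hash_arg R T C -> C) (HASH_inj : injective HASH)
    (col : nat -> C) (col_inj : injective col)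
    (l : G * G -> nat) (l' : G' * G' -> nat)
    (hl : forall (s : G * G) (s' : G' * G'),
        l s = l' s' <-> pair_feature X s = pair_feature X' s')
    (t : R) (M : hopeDGN R) :
  forall (j : nat) (u v : G) (u' v' : G'),
    dwl2 HASH col l t j (u, v) = dwl2 HASH col l' t j (u', v') ->
    embedding M X T t j (u, v) = embedding M X' T t j (u', v').
Proof.
have l_swap u v u' v' : l (u, v) = l' (u', v') -> l (v, u) = l' (v', u').
  by move/hl/pair_feature_swap/hl.
have c_swap := dwl2_swap (t := t) HASH_inj col_inj l_swap.
elim=> [|j IHj] u v u' v' /=; first by move/col_inj/hl.
move/HASH_inj => [/IHj-> eq_ms]; congr (update M _ (agg M _)).
apply: msetmap_factor eq_ms => w w' /=.
case/pair_equal_spec=> /pair_equal_spec[].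
(* Only the color of [(w, v)] has to be reversed; that of [(u, w)] already has the orientation used
   by [embedding]. *)
case/pair_equal_spec=> /c_swap/IHj-> /IHj-> Au Av.
have /= -> := congr1 val (time_interval_vec_factor Au).
by have /= -> := congr1 val (time_interval_vec_factor Av).
Qed.
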